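(* As formal power series in $x$, $$\sum_{n\ge 0}|\mathcal{M}_n(P_1,P_2,P_3)|\,x^n=\frac{1-4x+7x^2-5x^3+2x^4-x^5+x^6}{(1-x)^5}.$$
   Context: A matching with $n$ arcs is a partition of $\{1,2,\ldots,2n\}$ into blocks of size 2, called arcs; an arc is written $[a,b]$ with $a<b$, where $a$ is its opener and $b$ its closer. For $n=0$ there is exactly one (empty) matching. A matching is Stoimenow if it contains no pair of arcs $[i,\ell],[i+1,k]$ with $i+1<k<\ell$ (Type 1) and no pair of arcs $[k,j+1],[\ell,j]$ with $k<\ell<j$ (Type 2). A matching $M$ contains a pattern (a matching) $P$ with $m$ arcs if some $m$ arcs of $M$ become $P$ after their $2m$ endpoints are relabelled $1,\ldots,2m$ in the order-preserving way; otherwise $M$ avoids $P$. $\mathcal{M}_n(Q_1,\ldots,Q_r)$ denotes the set of Stoimenow matchings with $n$ arcs avoiding every one of $Q_1,\ldots,Q_r$. The patterns are $P_1=\{[1,3],[2,7],[4,5],[6,8]\}$, $P_2=\{[1,3],[2,5],[4,7],[6,8]\}$, $P_3=\{[1,2],[3,5],[4,6],[7,8]\}$. *)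

(* Defs.v *)
From mathcomp Require Import all_boot all_order all_algebra.
Set Implicit Arguments.
Unset Strict Implicit.
Unset Printing Implicit Defensive.
Import GRing.Theory.

(* The points 1, ..., 2n are represented by 'I_(2 * n): the point p is the
   ordinal of value p - 1. *)
Definition is_matching n (M : {set {set 'I_(2 * n)}}) : bool :=
  partition M [set: 'I_(2 * n)] && [forall B in M, #|B| == 2].

Definition is_arc n (M : {set {set 'I_(2 * n)}}) (a b : 'I_(2 * n)) : bool :=
  (a < b) && ([set a; b] \in M).

(* [i, l] and [h, k] with h = i + 1 < k < l *)
Definition has_type1 n (M : {set {set 'I_(2 * n)}}) : bool :=
  [exists i : 'I_(2 * n), exists h : 'I_(2 * n), exists k : 'I_(2 * n),
   exists l : 'I_(2 * n),
    [&& is_arc M i l, is_arc M h k, h == i.+1 :> nat, h < k & k < l]].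

(* [k, h] and [l, j] with h = j + 1 and k < l < j *)
Definition has_type2 n (M : {set {set 'I_(2 * n)}}) : bool :=
  [exists j : 'I_(2 * n), exists h : 'I_(2 * n), exists k : 'I_(2 * n),
   exists l : 'I_(2 * n),
    [&& is_arc M k h, is_arc M l j, h == j.+1 :> nat, k < l & l < j]].

Definition is_stoimenow n (M : {set {set 'I_(2 * n)}}) : bool :=
  [&& is_matching M, ~~ has_type1 M & ~~ has_type2 M].

Record pattern := Pattern {
  pattern_size : nat;
  pattern_arcs : {set {set 'I_(2 * pattern_size)}};
  pattern_matching : is_matching pattern_arcs
}.

(* The increasing map f is the inverse of the relabelling of the endpoints of
   the arcs in S. *)
Definition contains n (M : {set {set 'I_(2 * n)}}) (P : pattern) : bool :=
  let m := pattern_size P in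
  [exists S : {set {set 'I_(2 * n)}},
    [&& S \subset M, #|S| == m &
      [exists f : {ffun 'I_(2 * m) -> 'I_(2 * n)},
        [forall a : 'I_(2 * m), forall b : 'I_(2 * m),
           (a < b) ==> (f a < f b)] &&
        (S == [set f @: (B : {set 'I_(2 * m)}) | B in pattern_arcs P])]]].

Definition stoimenow_avoiding n (Qs : seq pattern) :
    {set {set {set 'I_(2 * n)}}} :=
  [set M | is_stoimenow M && all (fun Q => ~~ contains M Q) Qs].

(* The arcs [a, b] for (a, b) in s, with endpoints labelled 1, ..., 2m. *)
Definition arcs_of m (s : seq (nat * nat)) : {set {set 'I_(2 * m)}} :=
  [set:: [seq [set i : 'I_(2 * m) | (i.+1 == ab.1) || (i.+1 == ab.2)]
         | ab <- s]].

Lemma arcs_of_matching m (s : seq (nat * nat)) :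
  all (fun ab => ab.1 < ab.2) s ->
  perm_eq (flatten [seq [:: ab.1; ab.2] | ab <- s]) (iota 1 (2 * m)) ->
  is_matching (arcs_of m s).
Proof.
move=> /allP lt_s perm_s.
have size_s : size s = m.
  apply/eqP; rewrite -(eqn_pmul2l (isT : 0 < 2)) -[X in _ == X](size_iota 1).
  rewrite -(perm_size perm_s) size_flatten /shape -map_comp sumnE big_map /=.
  by rewrite big_const_seq count_predT iter_addn_0.
have card2 B : B \in arcs_of m s -> #|B| = 2.
  rewrite inE => /mapP[[a b] ab_s ->] /=.
  have in_iota x : x \in [:: a; b] -> 0 < x < (2 * m).+1.
    move=> x_ab; rewrite -[(2 * m).+1]add1n -mem_iota -(perm_mem perm_s).
    by apply/flatten_mapP; exists (a, b).
  have /andP[a0 am] := in_iota a (mem_head _ _).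
  have /andP[b0 bm] : 0 < b < (2 * m).+1 by apply: in_iota; rewrite !inE eqxx orbT.
  case: a b a0 b0 am bm ab_s {in_iota} => [//|a] [//|b] _ _ am bm /lt_s /= lt_ab.
  have -> : [set i : 'I_(2 * m) | (i.+1 == a.+1) || (i.+1 == b.+1)]
            = [set Ordinal (am : a < 2 * m); Ordinal (bm : b < 2 * m)]
    by apply/setP => i; rewrite !inE.
  by rewrite cards2 -val_eqE /= neq_ltn (lt_ab : a < b).
have cover_s : cover (arcs_of m s) = [set: 'I_(2 * m)].
  apply/setP => i; rewrite inE; apply/bigcupP.
  have : i.+1 \in iota 1 (2 * m) by rewrite mem_iota /= add1n ltnS.
  rewrite -(perm_mem perm_s) => /flatten_mapP[ab ab_s i_ab].
  exists [set i : 'I_(2 * m) | (i.+1 == ab.1) || (i.+1 == ab.2)].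
    by rewrite inE; apply/mapP; exists ab.
  by move: i_ab; rewrite !inE.
apply/andP; split; last by apply/forall_inP => B /card2 ->.
apply/and3P; split; first by rewrite cover_s.
  rewrite /trivIset eqn_leq leq_card_cover andbT cover_s cardsT card_ord.
  rewrite (eq_bigr (fun=> 2)) => [|B /card2 //].
  rewrite sum_nat_const mulnC leq_mul2l /= -[X in _ <= X]size_s.
  rewrite -(size_map (fun ab => [set i : 'I_(2 * m) | (i.+1 == ab.1) || (i.+1 == ab.2)])).
  by rewrite (leq_trans _ (card_size _)) // cardsE.
by apply/negP => /card2; rewrite cards0.
Qed.

Definition pattern_of m (s : seq (nat * nat))
    (lt_s : all (fun ab => ab.1 < ab.2) s)
    (perm_s : perm_eq (flatten [seq [:: ab.1; ab.2] | ab <- s])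
                      (iota 1 (2 * m))) : pattern :=
  Pattern (arcs_of_matching lt_s perm_s).

Definition P1 : pattern :=
  @pattern_of 4 [:: (1, 3); (2, 7); (4, 5); (6, 8)] isT isT.
Definition P2 : pattern :=
  @pattern_of 4 [:: (1, 3); (2, 5); (4, 7); (6, 8)] isT isT.
Definition P3 : pattern :=
  @pattern_of 4 [:: (1, 2); (3, 5); (4, 6); (7, 8)] isT isT.

(* A formal power series is its sequence of coefficients; equality of series
   is the pointwise equality =1. *)
Section PowerSeries.
Local Open Scope ring_scope.
Variable K : fieldType.

Definition fps := nat -> K.

Definition fps_of_poly (p : {poly K}) : fps := fun n => p`_n.

Definition fps_mul (f g : fps) : fps :=
  fun n => \sum_(k < n.+1) f k * g (n - k)%N.

(* The coefficients of index < n of the inverse of f, computed from f g = 1. *)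
Fixpoint fps_inv_coefs (f : fps) (n : nat) : seq K :=
  if n is m.+1 then
    let s := fps_inv_coefs f m in
    rcons s (((m == 0)%:R - \sum_(k < m) s`_k * f (m - k)%N) / f 0%N)
  else [::].

(* The multiplicative inverse when f 0 != 0, see fps_mulVf. *)
Definition fps_inv (f : fps) : fps := fun n => (fps_inv_coefs f n.+1)`_n.

Definition fps_div (f g : fps) : fps := fps_mul f (fps_inv g).

Lemma size_fps_inv_coefs f n : size (fps_inv_coefs f n) = n.
Proof. by elim: n => //= n IHn; rewrite size_rcons IHn. Qed.

Lemma nth_fps_inv_coefs f n k : (k < n)%N -> (fps_inv_coefs f n)`_k = fps_inv f k.
Proof.
elim: n => // n IHn; rewrite ltnS leq_eqVlt => /predU1P[->//|lt_kn].
by rewrite /= nth_rcons size_fps_inv_coefs lt_kn IHn.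
Qed.

Lemma fps_mulVf (f : fps) : f 0%N != 0 ->
  fps_mul (fps_inv f) f =1 fps_of_poly 1.
Proof.
move=> f0 n; rewrite /fps_mul /fps_of_poly coef1 big_ord_recr /= subnn.
rewrite {2}/fps_inv /= nth_rcons size_fps_inv_coefs ltnn eqxx divfK //.
rewrite addrC -[RHS]addr0 -[in RHS](subrr (\sum_(i < n) fps_inv f i * f (n - i)%N)).
rewrite addrA addrAC; congr (_ - _ + _).
by apply: eq_bigr => i _; rewrite nth_fps_inv_coefs.
Qed.

End PowerSeries.

(* Main.v *)
Require Import Defs.
From mathcomp Require Import all_boot all_order all_algebra.
From mathcomp Require Import zify ring.
Set Implicit Arguments.
Unset Strict Implicit.
Unset Printing Implicit Defensive.

(** Order the arcs of a matching by [a, b] < [c, d] when b < c.  A Stoimenow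
    matching is the canonical interval representation of this poset, and P1,
    P2, P3 represent the poset 3 + 1 (a chain of length three and a point), the
    poset N, and the diamond (a point below two incomparable points below a
    point).  So the matchings to count correspond to the posets without 2 + 2,
    3 + 1, N and diamond, and these are easy to list: being N-free they are
    built by disjoint unions and ordinal sums.  Write A_k for the antichain on k
    points, + for the disjoint union and * for the ordinal sum.  Excluding 2 + 2
    and 3 + 1 leaves as sum-indecomposable pieces the A_k and the
    A_k + (A_a * A_b); excluding the diamond forces every inner summand of an
    ordinal sum to be a point, and the first (resp. last) to be A_k or
    A_k + (A_a * A_1) (resp. A_k or A_k + (A_1 * A_b)).

    The proof below carries this out on matchings, with no isomorphism of posets.
    In a Stoimenow matching, a nested pair of arcs always extends to an
    occurrence of P1 (avoids_P1_nonnesting), so avoiding P1 means being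
    nonnesting.  A nonnesting matching is determined by its height function h,
    where h j is the number of arcs lying entirely to the left of the j-th arc,
    and every nondecreasing h with h j <= j occurs (nonnesting_height,
    height_matching_inj).  Avoiding P2 and P3 turns into inequalities on four
    values of h (height_N_freeP, height_diamond_freeP).  Their solutions are
    explicit functions with four parameters (height_codeP), one for each of the
    posets listed above, and the admissible parameters are increasing tuples in
    five disjoint families, plus one antichain.  This gives the number
      1 + C(n-1, 2) + C(n, 2) + 2 C(n-1, 3) + C(n-2, 4)
    of matchings (card_stoimenow_avoiding).  The coefficients of 1 / (1 - x)^5
    are the C(n+4, 4), and the two sides agree by Pascal's rule. *)

(** * Arcs of a matching *)

Section Matching.
Variables (n : nat) (M : {set {set 'I_(2 * n)}}).
Implicit Types x y z : 'I_(2 * n).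

Lemma card_matching : is_matching M -> #|M| = n.
Proof.
case/andP=> partM /forall_inP cardM; apply/eqP.
rewrite -(eqn_pmul2l (isT : 0 < 2)) -[X in _ == X]card_ord -cardsT mulnC.
by rewrite (card_uniform_partition (n := 2) _ partM) // => B /cardM/eqP.
Qed.

Lemma matching_partner_uniq x y z : is_matching M ->
  [set x; y] \in M -> [set x; z] \in M -> y = z.
Proof.
case/andP=> /and3P[_ tiM _] _ xyM xzM.
have eq_xyz : [set x; y] = [set x; z].
  by rewrite -(def_pblock tiM xyM (set21 x y)) -(def_pblock tiM xzM (set21 x z)).
have : y \in [set x; z] by rewrite -eq_xyz set22.
have : z \in [set x; y] by rewrite eq_xyz set22.
by rewrite !inE => /orP[/eqP->|/eqP->//] /orP[/eqP|/eqP].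
Qed.

Lemma arc_closer_uniq x y z : is_matching M -> is_arc M x y -> is_arc M x z -> y = z.
Proof. by move=> mM /andP[_ xyM] /andP[_]; apply: matching_partner_uniq xyM. Qed.

Lemma arc_opener_uniq x y z : is_matching M -> is_arc M x z -> is_arc M y z -> x = y.
Proof.
by move=> mM /andP[_ xzM] /andP[_]; rewrite setUC; apply: matching_partner_uniq; rewrite // setUC.
Qed.

Lemma arc_opener_closer x y z : is_matching M -> is_arc M x y -> is_arc M y z -> False.
Proof.
move=> mM /andP[ltxy xyM] /andP[ltyz yzM].
have eq_xz : x = z by apply: (matching_partner_uniq mM _ yzM); rewrite setUC.
by move: ltxy ltyz; rewrite eq_xz; lia.
Qed.

Lemma matching_arc x : is_matching M -> exists y, is_arc M x y \/ is_arc M y x.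
Proof.
case/andP=> /and3P[/eqP covM _ _] /forall_inP cardM.
have /bigcupP[B BM xB] : x \in cover M by rewrite covM inE.
have /cards2P[u [v [ne_uv defB]]] := cardM B BM.
have ltuv : (u < v) || (v < u) by rewrite -neq_ltn; apply: contra ne_uv => /eqP/val_inj->.
have vuM : [set v; u] \in M by rewrite setUC -defB.
rewrite {}defB in BM xB; move: xB; rewrite !inE => /orP[] /eqP->; case/orP: ltuv => lt.
- by exists v; left; rewrite /is_arc lt.
- by exists v; right; rewrite /is_arc lt.
- by exists u; right; rewrite /is_arc lt.
- by exists u; left; rewrite /is_arc lt.
Qed.

Definition nonnesting := forall a b c d : 'I_(2 * n),
  is_arc M a b -> is_arc M c d -> a < c -> b < d.

Lemma nonnesting_stoimenow : is_matching M -> nonnesting -> is_stoimenow M.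
Proof.
move=> mM nnM; apply/and3P; split=> //; apply/negP.
  case/existsP=> i /existsP[h /existsP[k /existsP[l]]].
  by case/and5P=> il hk /eqP hi _ ltkl; have := nnM _ _ _ _ il hk; lia.
case/existsP=> j /existsP[h /existsP[k /existsP[l]]].
by case/and5P=> kh lj /eqP hj ltkl _; have := nnM _ _ _ _ kh lj; lia.
Qed.

(** Walk to the right from the opener b1 of the outer arc.  While the next point
    is an opener, its arc must close after b2 (otherwise it forms a Type 1 pair
    with the arc of b1), so it again encloses [c1, c2]; the walk cannot reach c1
    in this way, hence meets a closer before, and its arc was opened before
    b1. *)
Lemma nested_left : is_stoimenow M -> forall b1 b2 c1 c2,
  is_arc M b1 b2 -> is_arc M c1 c2 -> b1 < c1 -> c2 < b2 ->
  exists e1 e2, [/\ is_arc M e1 e2, e1 < b1, b1 < e2 & e2 < c1].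
Proof.
case/and3P=> mM no1 _ b1 b2 c1 c2.
have [k] := ubnP (c1 - b1); elim: k b1 b2 => // k IHk b1 b2 ltk B C lt1 lt2.
have lt_c1 := ltn_ord c1.
have ltb : b1.+1 < 2 * n by lia.
pose x := Ordinal ltb.
have not1 y : is_arc M x y -> b2 < y.
  move=> xy; rewrite ltnNge leq_eqVlt; apply/negP => /orP[/eqP/val_inj eqy|lty].
    by rewrite eqy in xy; have := arc_opener_uniq mM B xy => /(congr1 val) /=; lia.
  case/negP: no1; apply/existsP; exists b1; apply/existsP; exists x.
  apply/existsP; exists y; apply/existsP; exists b2.
  by rewrite B xy lty eqxx; case/andP: xy => ->.
case: (matching_arc x mM) => y [xy|yx].
  have lt_b2y := not1 y xy.
  have ne_xc1 : x != c1.
    by apply: contraTneq lt_b2y => eqx; rewrite eqx in xy; rewrite (arc_closer_uniq mM xy C); lia.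
  have ltxc : x < c1 by rewrite ltn_neqAle ne_xc1 /=; lia.
  have [||e1 [e2 [E lt_e1 lt_e2 lt_c]]] := IHk x y _ xy C ltxc; [rewrite /=; lia|lia|].
  exists e1, e2; split=> //; last by apply: leq_trans lt_e2; rewrite /=; lia.
  rewrite ltn_neqAle -ltnS lt_e1 andbT; apply/eqP => /val_inj eqe.
  rewrite eqe in E; have eqb := arc_closer_uniq mM B E.
  by move: lt2 lt_c; rewrite eqb; case/andP: C; lia.
exists y, x; split=> //=.
  rewrite ltn_neqAle -ltnS; case/andP: (yx) => /= -> _; rewrite andbT.
  apply/eqP => /val_inj eqy; rewrite eqy in yx.
  by have := arc_closer_uniq mM B yx => /(congr1 val) /=; case/andP: C; lia.
rewrite ltn_neqAle lt1 andbT; apply/eqP => eqx.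
have {}eqx : x = c1 by apply: val_inj.
by rewrite eqx in yx; apply: (arc_opener_closer mM yx C).
Qed.

(** The mirror image of nested_left, with Type 2 pairs in place of Type 1. *)
Lemma nested_right : is_stoimenow M -> forall b1 b2 c1 c2,
  is_arc M b1 b2 -> is_arc M c1 c2 -> b1 < c1 -> c2 < b2 ->
  exists f1 f2, [/\ is_arc M f1 f2, c2 < f1, f1 < b2 & b2 < f2].
Proof.
case/and3P=> mM _ no2 b1 b2 c1 c2.
have [k] := ubnP (b2 - c2); elim: k b1 b2 => // k IHk b1 b2 ltk B C lt1 lt2.
have lt_b2 := ltn_ord b2.
have ltb : b2.-1 < 2 * n by lia.
pose x := Ordinal ltb.
have not2 y : is_arc M y x -> y < b1.
  move=> yx; rewrite ltnNge leq_eqVlt; apply/negP => /orP[/eqP/val_inj eqy|lty].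
    by rewrite -eqy in yx; have := arc_closer_uniq mM B yx => /(congr1 val) /=; lia.
  case/negP: no2; apply/existsP; exists x; apply/existsP; exists b2.
  apply/existsP; exists b1; apply/existsP; exists y.
  by rewrite B yx lty /=; case/andP: yx => /= -> _; rewrite andbT; lia.
case: (matching_arc x mM) => y [xy|yx]; last first.
  have lt_yb1 := not2 y yx.
  have ne_xc2 : x != c2.
    by apply: contraTneq lt_yb1 => eqx; rewrite eqx in yx; rewrite (arc_opener_uniq mM yx C); lia.
  have ltcx : c2 < x by rewrite ltn_neqAle eq_sym ne_xc2 /=; lia.
  have [||f1 [f2 [F lt_f1 lt_f2 lt_c]]] := IHk y x _ yx C _ ltcx; [rewrite /=; lia|lia|].
  rewrite /= in lt_f2 lt_c.
  exists f1, f2; split=> //; first by lia.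
  rewrite ltn_neqAle; apply/andP; split; last by lia.
  apply/eqP => /val_inj eqf; rewrite -eqf in F.
  by have := arc_opener_uniq mM B F => /(congr1 val) /=; case/andP: C; lia.
have lt_xy : b2.-1 < y by case/andP: xy.
exists x, y; split=> //=; last 2 first.
- by lia.
- rewrite ltn_neqAle; apply/andP; split; last by lia.
  apply/eqP => /val_inj eqy; rewrite -eqy in xy.
  by have := arc_opener_uniq mM B xy => /(congr1 val) /=; case/andP: C; lia.
rewrite ltn_neqAle; apply/andP; split; last by lia.
apply/eqP => eqx; have {}eqx : c2 = x by apply: val_inj.
by rewrite -eqx in xy; apply: (arc_opener_closer mM C xy).
Qed.

End Matching.

(** * Pattern containment *)

(** An increasing map sends distinct arcs to distinct arcs, and a matching on 2m
    points has m arcs, so the image of the pattern has the right number of arcs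
    for any increasing f. *)
Lemma contains_pattern_ofP n (M : {set {set 'I_(2 * n)}}) m (s : seq (nat * nat))
    (lt_s : all (fun ab => ab.1 < ab.2) s)
    (perm_s : perm_eq (flatten [seq [:: ab.1; ab.2] | ab <- s]) (iota 1 (2 * m))) :
  reflect (exists2 f : 'I_(2 * m) -> 'I_(2 * n),
     {homo f : a b / a < b} &
     forall a b : 'I_(2 * m), (a.+1, b.+1) \in s -> is_arc M (f a) (f b))
   (contains M (pattern_of lt_s perm_s)).
Proof.
have in_s ab : ab \in s -> exists a b : 'I_(2 * m), ab = (a.+1, b.+1).
  move=> ab_s; have in_iota x : x \in [:: ab.1; ab.2] -> exists a : 'I_(2 * m), x = a.+1.
    move=> x_ab; have : x \in iota 1 (2 * m).
      by rewrite -(perm_mem perm_s); apply/flatten_mapP; exists ab.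
    rewrite mem_iota add1n => /andP[]; case: x {x_ab} => // x _.
    by rewrite ltnS => lt; exists (Ordinal lt).
  have [a eqa] := in_iota ab.1 (mem_head _ _).
  have [|b eqb] := in_iota ab.2; first by rewrite !inE eqxx orbT.
  by exists a, b; rewrite -eqa -eqb; case: (ab).
have arcE (a b : 'I_(2 * m)) : [set i : 'I_(2 * m) | (i.+1 == a.+1) || (i.+1 == b.+1)] = [set a; b].
  by apply/setP => i; rewrite !inE.
apply: (iffP existsP) => [[S /and3P[SM _ /existsP[f]]]|[f f_lt f_arc]].
  case/andP=> /forallP f_lt /eqP defS.
  exists f => [a b lt_ab|a b ab_s].
    by move: (f_lt a) => /forallP/(_ b)/implyP; apply.
  have lt_ab : a < b by have := allP lt_s _ ab_s; rewrite /= ltnS.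
  apply/andP; split; first by move: (f_lt a) => /forallP/(_ b)/implyP; apply.
  apply: (subsetP SM); rewrite defS; apply/imsetP.
  exists [set a; b]; last by rewrite imsetU !imset_set1.
  by rewrite inE; apply/mapP; exists (a.+1, b.+1); rewrite //= arcE.
have f_inj : injective f.
  move=> a b eq_ab; apply/val_inj/eqP; rewrite /= -[_ == _]negbK neq_ltn.
  by apply/negP => /orP[] /f_lt; rewrite eq_ab ltnn.
exists [set f @: (B : {set 'I_(2 * m)}) | B in arcs_of m s]; apply/and3P; split.
- apply/subsetP => _ /imsetP[B + ->]; rewrite inE => /mapP[ab ab_s ->].
  have [a [b eq_ab]] := in_s _ ab_s; rewrite eq_ab /= arcE imsetU !imset_set1.
  by rewrite eq_ab in ab_s; case/andP: (f_arc _ _ ab_s).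
- rewrite card_imset; last exact: imset_inj.
  by rewrite card_matching // arcs_of_matching.
apply/existsP; exists (finfun f); apply/andP; split.
  by apply/forallP=> a; apply/forallP=> b; apply/implyP; rewrite !ffunE; apply: f_lt.
by apply/eqP/eq_imset => B; apply: eq_imset => a; rewrite ffunE.
Qed.

(** In a nested pair B, C of a Stoimenow matching, the arc E that closes between
    the openers and the arc F that opens between the closers give E < C < F,
    while B meets all three: this is P1. *)
Lemma avoids_P1_nonnesting n (M : {set {set 'I_(2 * n)}}) :
  is_stoimenow M -> ~~ contains M P1 -> nonnesting M.
Proof.
move=> stM /negP noP1 b1 b2 c1 c2 B C lt1; rewrite ltnNge leq_eqVlt.
have mM : is_matching M by case/and3P: stM.
apply/negP => /orP[/eqP/val_inj eq2|lt2].
  by rewrite eq2 in C; have := arc_opener_uniq mM B C => eq1; rewrite eq1 ltnn in lt1.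
have [e1 [e2 [E lt_e1 lt_e2 lt_ec]]] := nested_left stM B C lt1 lt2.
have [f1 [f2 [F lt_f1 lt_f2 lt_fb]]] := nested_right stM B C lt1 lt2.
have lt_c : c1 < c2 by case/andP: C.
pose xs := [:: e1; b1; e2; c1; c2; f1; b2; f2].
apply: noP1; apply/contains_pattern_ofP; exists (fun i => nth e1 xs i) => [i j lt_ij|i j].
  apply: (sorted_ltn_nth (leT := fun x y : 'I_(2 * n) => x < y)) lt_ij;
    rewrite ?inE /= ?ltn_ord //; last by rewrite lt_e1 lt_e2 lt_ec lt_c lt_f1 lt_f2 lt_fb.
  by move=> ? ? ?; apply: ltn_trans.
by rewrite !inE !xpair_eqE => /or4P[] /andP[/eqP[->] /eqP[->]].
Qed.

Lemma nonnesting_avoids_P1 n (M : {set {set 'I_(2 * n)}}) :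
  nonnesting M -> ~~ contains M P1.
Proof.
move=> nnM; apply/negP => /contains_pattern_ofP[f f_lt f_arc].
pose i1 : 'I_(2 * 4) := @Ordinal 8 1 isT; pose i3 : 'I_(2 * 4) := @Ordinal 8 3 isT.
pose i4 : 'I_(2 * 4) := @Ordinal 8 4 isT; pose i6 : 'I_(2 * 4) := @Ordinal 8 6 isT.
have := nnM _ _ _ _ (f_arc i1 i6 isT) (f_arc i3 i4 isT) (f_lt i1 i3 isT).
by have := f_lt i4 i6 isT; lia.
Qed.

(** * Nonnesting matchings and their height functions *)

(** These functions encode the Dyck paths of semilength n: h j is the number of
    down-steps before the j-th up-step, where up-steps are numbered from 0. *)
Definition is_height n (h : nat -> nat) :=
  (forall i j, i <= j -> j < n -> h i <= h j) /\ (forall j, j < n -> h j <= j).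

(** Arcs are numbered from 0, so in the ordered arcs the arc i lies entirely to
    the left of the arc j exactly when i < h j.  The conditions exclude an
    increasing quadruple of arcs that forms P2, resp. P3. *)
Definition N_free n (h : nat -> nat) := forall i1 i2 i3 i4,
  i1 < i2 -> i2 < i3 -> i3 < i4 -> i4 < n ->
  ~~ [&& h i2 <= i1, i1 < h i3, h i3 <= i2, i2 < h i4 & h i4 <= i3].

Definition diamond_free n (h : nat -> nat) := forall i1 i2 i3 i4,
  i1 < i2 -> i2 < i3 -> i3 < i4 -> i4 < n ->
  ~~ [&& i1 < h i2, h i3 <= i2 & i3 < h i4].

(** Before the j-th opener there are j openers and h j closers; before the i-th
    closer there are i closers and the openers of the arcs that are not
    entirely to the right of the arc i. *)
Definition opener (h : nat -> nat) j := j + h j.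
Definition closer n (h : nat -> nat) i := i + count (fun j => h j <= i) (iota 0 n).
Definition height_arcs n h := [seq ((opener h j).+1, (closer n h j).+1) | j <- iota 0 n].
Definition height_matching n h := arcs_of n (height_arcs n h).

(** A set of integers below n that is closed downwards is an initial segment, and
    so is determined by its cardinality. *)
Lemma ltn_count_iota n (P : pred nat) j :
  (forall i k, i <= k -> k < n -> P k -> P i) -> j < n -> (j < count P (iota 0 n)) = P j.
Proof.
move=> Pdown; elim: n Pdown => // n IHn Pdown; rewrite ltnS => le_jn.
rewrite -[n.+1]addn1 iotaD count_cat /= add0n addn0.
have le_cn : count P (iota 0 n) <= n by rewrite -{2}(size_iota 0 n) count_size.
case Pn : (P n).
  rewrite (Pdown j n) // (_ : count P _ = n) ?addn1 ?ltnS //.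
  rewrite -{2}(size_iota 0 n); apply/eqP; rewrite -all_count; apply/allP => i.
  by rewrite mem_iota => lt_i; apply: Pdown Pn; lia.
rewrite addn0; case: (ltnP j n) => [lt_jn|ge_jn].
  by apply: IHn => // i k le_ik lt_kn; apply: Pdown => //; apply: ltnW.
have -> : j = n by lia.
by rewrite Pn; lia.
Qed.

Section Heights.
Variables (n : nat) (h : nat -> nat).
Hypothesis hP : is_height n h.

Lemma ltn_count_height i j : j < n -> (j < count (fun k => h k <= i) (iota 0 n)) = (h j <= i).
Proof.
case: hP => mono _; apply: ltn_count_iota => k l le_kl lt_ln.
by apply: leq_trans; apply: mono.
Qed.

Lemma opener_closer i j : i < n -> j < n ->
  if h j <= i then opener h j < closer n h i else closer n h i < opener h j.
Proof.
by move=> lt_in lt_jn; have := ltn_count_height i lt_jn; rewrite /opener /closer; case: ifP; lia.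
Qed.

Lemma opener_mono i j : i < j -> j < n -> opener h i < opener h j.
Proof. by case: hP => mono _ lt_ij lt_jn; rewrite /opener; have := mono i j; lia. Qed.

Lemma closer_mono i j : i < j -> closer n h i < closer n h j.
Proof.
move=> lt_ij; rewrite /closer -addSn leq_add //.
by apply: sub_count => k /= /leq_trans; apply; apply: ltnW.
Qed.

Lemma opener_mono_iff i j : i < n -> j < n -> (opener h i < opener h j) = (i < j).
Proof.
move=> lt_in lt_jn; case: (ltngtP i j) => [lt|gt|->]; last by rewrite ltnn.
  by rewrite opener_mono.
by have := opener_mono gt lt_in; lia.
Qed.

Lemma closer_mono_iff i j : (closer n h i < closer n h j) = (i < j).
Proof.
case: (ltngtP i j) => [lt|gt|->]; [by rewrite closer_mono| |by rewrite ltnn].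
by have := closer_mono gt; lia.
Qed.

Lemma opener_lt_closer i j : i < n -> j < n -> (opener h j < closer n h i) = (h j <= i).
Proof. by move=> lt_in lt_jn; have := opener_closer lt_in lt_jn; case: ifP; lia. Qed.

Lemma closer_lt_opener i j : i < n -> j < n -> (closer n h i < opener h j) = (i < h j).
Proof. by move=> lt_in lt_jn; have := opener_closer lt_in lt_jn; case: ifP; lia. Qed.

Lemma opener_bound j : j < n -> opener h j < 2 * n.
Proof. by case: hP => _ le_h lt_jn; rewrite /opener; have := le_h j; lia. Qed.

Lemma closer_bound j : j < n -> closer n h j < 2 * n.
Proof.
rewrite /closer; have := count_size (fun k => h k <= j) (iota 0 n).
by rewrite size_iota; lia.
Qed.

Lemma height_arcs_lt : all (fun ab => ab.1 < ab.2) (height_arcs n h).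
Proof.
apply/allP => _ /mapP[j + ->]; rewrite mem_iota /= ltnS => lt_jn.
by rewrite opener_lt_closer //; case: hP => _; apply.
Qed.

Lemma height_arcs_perm :
  perm_eq (flatten [seq [:: ab.1; ab.2] | ab <- height_arcs n h]) (iota 1 (2 * n)).
Proof.
set s := [seq (opener h j).+1 | j <- iota 0 n] ++ [seq (closer n h j).+1 | j <- iota 0 n].
have /permPl -> : perm_eq (flatten [seq [:: ab.1; ab.2] | ab <- height_arcs n h]) s.
  rewrite /s /height_arcs -map_comp; elim: (iota 0 n) => //= j r IHr.
  by rewrite perm_cons perm_sym -cat1s perm_catCA /= perm_cons perm_sym.
have s_uniq : uniq s.
  rewrite cat_uniq; apply/and3P; split.
  - rewrite map_inj_in_uniq ?iota_uniq // => i j; rewrite !mem_iota !add0n /= => lt_i lt_j [].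
    have := opener_mono_iff lt_i lt_j; have := opener_mono_iff lt_j lt_i; lia.
  - apply/hasPn => _ /mapP[i + ->]; rewrite mem_iota => lt_i.
    apply/mapP => -[j]; rewrite mem_iota => lt_j [].
    by have := @opener_closer i j; case: ifP; lia.
  rewrite map_inj_in_uniq ?iota_uniq // => i j _ _ [].
  have := closer_mono_iff i j; have := closer_mono_iff j i; lia.
have s_sub : {subset s <= iota 1 (2 * n)}.
  move=> x; rewrite mem_cat mem_iota => /orP[] /mapP[j]; rewrite mem_iota => lt_j ->.
    by have := @opener_bound j; lia.
  by have := @closer_bound j; lia.
apply: uniq_perm => //; first exact: iota_uniq.
by apply: (uniq_min_size s_uniq s_sub _).2; rewrite /s size_cat !size_map !size_iota; lia.
Qed.

Lemma height_matching_is_matching : is_matching (height_matching n h).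
Proof. exact: arcs_of_matching height_arcs_lt height_arcs_perm. Qed.

Lemma height_arcP (x y : 'I_(2 * n)) :
  reflect (exists2 j, j < n & x = opener h j :> nat /\ y = closer n h j :> nat)
          (is_arc (height_matching n h) x y).
Proof.
apply: (iffP andP) => [[lt_xy]|[j lt_jn [eqx eqy]]].
  rewrite inE => /mapP[ab ab_s /setP eq_xy].
  have lt_ab := allP height_arcs_lt _ ab_s.
  case/mapP: ab_s lt_ab eq_xy => j; rewrite mem_iota => lt_jn -> /= lt_oc eq_xy.
  exists j; first by lia.
  have := eq_xy x; have := eq_xy y; rewrite !inE !eqxx orbT /= => /esym + /esym.
  by rewrite !eqSS; lia.
split; first by rewrite eqx eqy opener_lt_closer //; case: hP => _; apply.
rewrite inE; apply/mapP; exists ((opener h j).+1, (closer n h j).+1).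
  by apply/mapP; exists j; rewrite ?mem_iota.
by apply/setP => i; rewrite !inE /= !eqSS -eqx -eqy.
Qed.

Lemma height_arc j : j < n -> exists x y : 'I_(2 * n),
  [/\ is_arc (height_matching n h) x y, x = opener h j :> nat & y = closer n h j :> nat].
Proof.
move=> lt_jn; exists (Ordinal (opener_bound lt_jn)), (Ordinal (closer_bound lt_jn)).
by split=> //; apply/height_arcP; exists j.
Qed.

Lemma height_matching_nonnesting : nonnesting (height_matching n h).
Proof.
move=> a b c d /height_arcP[i lt_i [-> ->]] /height_arcP[j lt_j [-> ->]].
by rewrite opener_mono_iff // closer_mono_iff.
Qed.

(** The endpoints of P2 come in the order o1 o2 c1 o3 c2 o4 c3 c4, where oi and ci
    are the ends of the i-th arc; each comparison of neighbours of different
    kinds is one of the inequalities of N_free. *)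
Lemma height_N_freeP : N_free n h <-> ~~ contains (height_matching n h) P2.
Proof.
split=> [av|noP2 i1 i2 i3 i4 lt12 lt23 lt34 lt4n].
  apply/negP => /contains_pattern_ofP[f f_lt f_arc].
  pose o k (lt_k : k < 8) : 'I_(2 * 4) := @Ordinal 8 k lt_k.
  have /height_arcP[i1 lt_1 [o1 c1]] := f_arc (@o 0 isT) (@o 2 isT) isT.
  have /height_arcP[i2 lt_2 [o2 c2]] := f_arc (@o 1 isT) (@o 4 isT) isT.
  have /height_arcP[i3 lt_3 [o3 c3]] := f_arc (@o 3 isT) (@o 6 isT) isT.
  have /height_arcP[i4 lt_4 [o4 c4]] := f_arc (@o 5 isT) (@o 7 isT) isT.
  have lt12 := f_lt (@o 0 isT) (@o 1 isT) isT.
  have lt23 := f_lt (@o 1 isT) (@o 3 isT) isT.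
  have lt34 := f_lt (@o 3 isT) (@o 5 isT) isT.
  have := f_lt (@o 1 isT) (@o 2 isT) isT; have := f_lt (@o 2 isT) (@o 3 isT) isT.
  have := f_lt (@o 3 isT) (@o 4 isT) isT; have := f_lt (@o 4 isT) (@o 5 isT) isT.
  have := f_lt (@o 5 isT) (@o 6 isT) isT.
  move: lt12 lt23 lt34; rewrite o1 o2 o3 o4 c1 c2 c3 !opener_mono_iff //.
  rewrite !opener_lt_closer // !closer_lt_opener // => lt12 lt23 lt34 h43 h24 h32 h13 h21.
  by case/negP: (av i1 i2 i3 i4 lt12 lt23 lt34 lt_4); rewrite h21 h13 h32 h24 h43.
apply: contra noP2 => /and5P[h21 h13 h32 h24 h43].
have [|x1 [y1 [A1 ox1 cy1]]] := @height_arc i1; first by lia.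
have [|x2 [y2 [A2 ox2 cy2]]] := @height_arc i2; first by lia.
have [|x3 [y3 [A3 ox3 cy3]]] := @height_arc i3; first by lia.
have [|x4 [y4 [A4 ox4 cy4]]] := @height_arc i4; first by lia.
pose xs := [:: x1; x2; y1; x3; y2; x4; y3; y4].
apply/contains_pattern_ofP; exists (fun i => nth x1 xs i) => [i j lt_ij|i j].
  apply: (sorted_ltn_nth (leT := fun x y : 'I_(2 * n) => x < y)) lt_ij;
    rewrite ?inE /= ?ltn_ord //; first by move=> ? ? ?; apply: ltn_trans.
  rewrite ox1 ox2 ox3 ox4 cy1 cy2 cy3 cy4.
  rewrite closer_mono_iff !opener_lt_closer ?closer_lt_opener ?opener_mono_iff; lia.
by rewrite !inE !xpair_eqE => /or4P[] /andP[/eqP[->] /eqP[->]].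
Qed.

(** The order of the endpoints in P3 is o1 c1 o2 o3 c2 c3 o4 c4. *)
Lemma height_diamond_freeP : diamond_free n h <-> ~~ contains (height_matching n h) P3.
Proof.
split=> [av|noP3 i1 i2 i3 i4 lt12 lt23 lt34 lt4n].
  apply/negP => /contains_pattern_ofP[f f_lt f_arc].
  pose o k (lt_k : k < 8) : 'I_(2 * 4) := @Ordinal 8 k lt_k.
  have /height_arcP[i1 lt_1 [o1 c1]] := f_arc (@o 0 isT) (@o 1 isT) isT.
  have /height_arcP[i2 lt_2 [o2 c2]] := f_arc (@o 2 isT) (@o 4 isT) isT.
  have /height_arcP[i3 lt_3 [o3 c3]] := f_arc (@o 3 isT) (@o 5 isT) isT.
  have /height_arcP[i4 lt_4 [o4 c4]] := f_arc (@o 6 isT) (@o 7 isT) isT.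
  have lt12 := f_lt (@o 0 isT) (@o 2 isT) isT.
  have lt34 := f_lt (@o 3 isT) (@o 6 isT) isT.
  have := f_lt (@o 1 isT) (@o 2 isT) isT; have := f_lt (@o 2 isT) (@o 3 isT) isT.
  have := f_lt (@o 3 isT) (@o 4 isT) isT; have := f_lt (@o 5 isT) (@o 6 isT) isT.
  move: lt12 lt34; rewrite o1 o2 o3 o4 c1 c2 c3 !opener_mono_iff // opener_lt_closer //.
  rewrite !closer_lt_opener // => lt12 lt34 h34 h32 lt23 h12.
  by case/negP: (av i1 i2 i3 i4 lt12 lt23 lt34 lt_4); rewrite h12 h32 h34.
apply: contra noP3 => /and3P[h12 h32 h34].
have [|x1 [y1 [A1 ox1 cy1]]] := @height_arc i1; first by lia.
have [|x2 [y2 [A2 ox2 cy2]]] := @height_arc i2; first by lia.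
have [|x3 [y3 [A3 ox3 cy3]]] := @height_arc i3; first by lia.
have [|x4 [y4 [A4 ox4 cy4]]] := @height_arc i4; first by lia.
have [lt_1 lt_4] : x1 < y1 /\ x4 < y4 by case/andP: A1 => -> _; case/andP: A4 => -> _.
pose xs := [:: x1; y1; x2; x3; y2; y3; x4; y4].
apply/contains_pattern_ofP; exists (fun i => nth x1 xs i) => [i j lt_ij|i j].
  apply: (sorted_ltn_nth (leT := fun x y : 'I_(2 * n) => x < y)) lt_ij;
    rewrite ?inE /= ?ltn_ord //; first by move=> ? ? ?; apply: ltn_trans.
  rewrite lt_1 lt_4 ox2 ox3 ox4 cy1 cy2 cy3.
  rewrite closer_mono_iff opener_lt_closer ?closer_lt_opener ?opener_mono_iff; lia.
by rewrite !inE !xpair_eqE => /or4P[] /andP[/eqP[->] /eqP[->]].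
Qed.

End Heights.

(** The openers, listed in increasing order, are the j + h j. *)
Lemma height_matching_inj n h k : is_height n h -> is_height n k ->
  height_matching n h = height_matching n k -> forall j, j < n -> h j = k j.
Proof.
move=> hP kP eq_hk j lt_jn.
have sorted_op g : is_height n g -> sorted ltn [seq opener g j | j <- iota 0 n].
  move=> gP; apply: (homo_sorted_in (P := gtn n)) (iota_ltn_sorted 0 n).
    by move=> a b _ lt_b lt_ab; apply: opener_mono gP _ _ lt_ab lt_b.
  by apply/allP => a; rewrite mem_iota.
have mem_op g x : is_height n g -> x \in [seq opener g j | j <- iota 0 n] <->
    exists a b : 'I_(2 * n), is_arc (height_matching n g) a b /\ x = a.
  move=> gP; split=> [/mapP[i]|[a [b [/(height_arcP gP)[i lt_in [-> _]] ->]]]].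
    by rewrite mem_iota => /(height_arc gP)[a [b [A <- _]]] ->; exists a, b.
  by rewrite map_f // mem_iota.
have eq_op : [seq opener h j | j <- iota 0 n] = [seq opener k j | j <- iota 0 n].
  apply: (irr_sorted_eq ltn_trans ltnn (sorted_op _ hP) (sorted_op _ kP)) => x.
  apply/idP/idP.
    by case/(mem_op _ _ hP) => a [b [A ->]]; apply/(mem_op _ _ kP); exists a, b; rewrite -eq_hk.
  by case/(mem_op _ _ kP) => a [b [A ->]]; apply/(mem_op _ _ hP); exists a, b; rewrite eq_hk.
have := congr1 (fun s => nth 0 s j) eq_op.
by rewrite /= !(nth_map 0) ?size_iota // nth_iota // add0n => /addnI.
Qed.

Lemma ltn_count_sorted s x j : sorted ltn s -> j < size s ->
  (j < count (gtn x) s) = (nth 0 s j < x).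
Proof.
move=> sort_s lt_js; rewrite -{1}(mkseq_nth 0 s) count_map.
apply: (@ltn_count_iota _ (preim (nth 0 s) (gtn x))) => // i k le_ik lt_ks /=.
apply: leq_trans; rewrite ltnS; move: le_ik; rewrite leq_eqVlt => /orP[/eqP-> //|lt_ik].
by apply/ltnW/(sorted_ltn_nth ltn_trans) => //; rewrite inE // (ltn_trans lt_ik).
Qed.

Lemma count_sorted_nth s j : sorted ltn s -> j < size s -> count (gtn (nth 0 s j)) s = j.
Proof.
move=> sort_s lt_js; apply/eqP; rewrite eqn_leq leqNgt (ltn_count_sorted _ sort_s) // ltnn /=.
case: j lt_js => // j lt_js; rewrite (ltn_count_sorted _ sort_s); last exact: ltnW.
by apply: (sorted_ltn_nth ltn_trans 0 sort_s); rewrite ?inE // ltnW.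
Qed.

(** Every point x is the number of openers before x plus the number of closers
    before x; applied to the openers and the closers themselves, this yields
    the formulas defining opener and closer. *)
Lemma split_iota_height n (os cs : seq nat) : sorted ltn os -> sorted ltn cs ->
  size os = n -> size cs = n -> perm_eq (os ++ cs) (iota 0 (2 * n)) ->
  (forall j, j < n -> nth 0 os j < nth 0 cs j) ->
  exists2 h, is_height n h &
    forall j, j < n -> nth 0 os j = opener h j /\ nth 0 cs j = closer n h j.
Proof.
move=> sort_o sort_c size_o size_c perm_oc lt_oc.
have pos x : x <= 2 * n -> x = count (gtn x) os + count (gtn x) cs.
  move=> le_x; rewrite -count_cat (permP perm_oc).
  rewrite -(subnKC le_x) iotaD count_cat.
  rewrite (_ : count _ (iota 0 x) = x); last first.
    rewrite -[RHS](size_iota 0); apply/eqP; rewrite -all_count; apply/allP => i.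
    by rewrite mem_iota /=; lia.
  rewrite (_ : count _ _ = 0) ?addn0 //; apply/eqP; rewrite -leqn0 leqNgt -has_count.
  by apply/hasPn => i; rewrite mem_iota /=; lia.
have bound x : x \in os ++ cs -> x <= 2 * n.
  by rewrite (perm_mem perm_oc) mem_iota; lia.
have bound_o j : j < n -> nth 0 os j <= 2 * n.
  by move=> lt_j; apply: bound; rewrite mem_cat mem_nth ?size_o.
have bound_c j : j < n -> nth 0 cs j <= 2 * n.
  by move=> lt_j; apply: bound; rewrite mem_cat mem_nth ?size_c ?orbT.
pose h j := count (gtn (nth 0 os j)) cs.
have os_h j : j < n -> nth 0 os j = opener h j.
  by move=> lt_j; rewrite /opener [LHS]pos ?bound_o // count_sorted_nth ?size_o.
have lt_c i j : i < n -> j < n -> (h i <= j) = (nth 0 os i < nth 0 cs j).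
  move=> lt_i lt_j; rewrite leqNgt (ltn_count_sorted _ sort_c) ?size_c // -leqNgt.
  rewrite leq_eqVlt; case: eqP => //= eq_oc.
  have : uniq (os ++ cs) by rewrite (perm_uniq perm_oc) iota_uniq.
  rewrite cat_uniq => /and3P[_ /hasPn/(_ (nth 0 cs j))].
  by rewrite -{2}eq_oc !mem_nth ?size_o ?size_c // => /(_ isT).
exists h.
  split=> [i j le_ij lt_j|j lt_j]; last by rewrite lt_c ?lt_oc.
  apply: sub_count => x /= /leq_trans; apply.
  move: le_ij; rewrite leq_eqVlt => /orP[/eqP->//|lt_ij].
  apply/ltnW/(sorted_ltn_nth ltn_trans 0 sort_o) => //; rewrite inE size_o //; lia.
move=> j lt_j; split; first exact: os_h.
rewrite /closer [LHS]pos ?bound_c // [X in _ + X]count_sorted_nth ?size_c // addnC; congr (_ + _).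
rewrite -{1}(mkseq_nth 0 os) count_map size_o; apply: eq_in_count => i.
by rewrite mem_iota => lt_i /=; rewrite lt_c //; lia.
Qed.

(** In a nonnesting matching the partners of the openers come in the same order
    as the openers, so the points split into two lists increasing in parallel. *)
Lemma nonnesting_height n (M : {set {set 'I_(2 * n)}}) : is_matching M -> nonnesting M ->
  exists2 h, is_height n h & M = height_matching n h.
Proof.
move=> mM nnM.
pose op x := [exists y, is_arc M x y].
pose pt x := odflt x [pick y | is_arc M x y].
have ptP x : op x -> is_arc M x (pt x).
  by rewrite /pt => /existsP[y xy]; case: pickP => //= /(_ y); rewrite xy.
pose opn := [seq x <- enum 'I_(2 * n) | op x].
have op_opn x : (x \in opn) = op x by rewrite mem_filter mem_enum andbT.
have perm_opn : perm_eq (opn ++ [seq pt x | x <- opn]) (enum 'I_(2 * n)).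
  apply: uniq_perm; rewrite ?enum_uniq //.
    rewrite cat_uniq (filter_uniq _ (enum_uniq _)) /=; apply/andP; split.
      apply/hasPn => _ /mapP[x + ->]; rewrite !op_opn => /ptP A.
      by apply/existsP => -[z]; apply: arc_opener_closer mM A.
    rewrite map_inj_in_uniq ?(filter_uniq _ (enum_uniq _)) // => x y.
    rewrite !op_opn => /ptP A /ptP B eq_xy; rewrite eq_xy in A.
    exact: arc_opener_uniq mM A B.
  move=> x; rewrite mem_cat mem_enum op_opn inE.
  have [y [xy|yx]] := matching_arc x mM; first by rewrite (_ : op x) //; apply/existsP; exists y.
  have op_y : op y by apply/existsP; exists x.
  by rewrite (arc_closer_uniq mM yx (ptP y op_y)) map_f ?orbT // op_opn.
have size_opn : size opn = n.
  have := perm_size perm_opn; rewrite size_cat size_map size_enum_ord addnn -mul2n.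
  by move/eqP; rewrite eqn_pmul2l // => /eqP.
pose os := [seq val x | x <- opn]; pose cs := [seq val (pt x) | x <- opn].
have sort_opn : sorted (fun x y : 'I_(2 * n) => x < y) opn.
  apply: sorted_filter => [? ? ?|]; first exact: ltn_trans.
  by have := iota_ltn_sorted 0 (2 * n); rewrite -val_enum_ord sorted_map.
have [||||||h hP hE] := @split_iota_height n os cs; rewrite ?size_map //.
- by rewrite sorted_map.
- rewrite sorted_map; apply: (sub_in_sorted (P := op)) sort_opn.
    by move=> x y /ptP A /ptP B /=; apply: nnM A B.
  by apply/allP => x; rewrite op_opn.
- by rewrite /os /cs -val_enum_ord (map_comp val pt) -map_cat perm_map.
- move=> j lt_j; have x0 : 'I_(2 * n) by apply: (@Ordinal _ 0); lia.
  rewrite !(nth_map x0) ?size_opn //.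
  have : nth x0 opn j \in opn by rewrite mem_nth ?size_opn.
  by rewrite op_opn => /ptP/andP[].
exists h => //; apply/eqP; rewrite eq_sym eqEcard !card_matching ?height_matching_is_matching //.
rewrite leqnn andbT; apply/subsetP => B; rewrite inE => /mapP[_ /mapP[j + ->] ->] /=.
rewrite mem_iota => lt_j; have x0 : 'I_(2 * n) by apply: (@Ordinal _ 0); lia.
have [] := hE j lt_j; rewrite !(nth_map x0) ?size_opn // => <- <-.
have : nth x0 opn j \in opn by rewrite mem_nth ?size_opn.
rewrite op_opn => /ptP/andP[_]; congr (_ \in M).
by apply/setP => i; rewrite !inE !eqSS.
Qed.

(** * Solving the inequalities on height functions *)

(** The parameters (a, p, s, q) of the function with values 0 before p, a at p,
    then min(j, s) before q, and s + 1 from q on.  For a < p < s and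
    s + 1 < q < n it is the height function of the ordinal sum of
    A_(p-a) + (A_a * A_1), then s - p - 1 points, then
    A_(q-s-1) + (A_1 * A_(n-q)).  If a = p, the first summand is instead A_p,
    followed by s - p points; if q = n, the last summand is A_(n-s). *)
Definition code : Type := nat * nat * nat * nat.

Definition code_height (c : code) (j : nat) : nat :=
  let: (a, p, s, q) := c in
  if j < p then 0 else if j == p then a else if j < q then minn j s else s.+1.

(** The three cases are the antichain A_n, the disjoint unions
    A_(p-a) + (A_a * A_(n-p)), and the ordinal sums of at least two summands. *)
Definition code_ok (n : nat) (c : code) : bool :=
  let: (a, p, s, q) := c in
  [|| [&& a == 0, p == 0, s == 0 & q == n],
      [&& 0 < a, a < p, p < n, s == a & q == n] |
      [&& 0 < a, (a < p < s) || (a == p) && (p <= s), s < n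
        & (q == n) || (s.+1 < q < n)]].

Lemma code_height_spec c j : let: (a, p, s, q) := c in
  [\/ j < p /\ code_height c j = 0,
      j = p /\ code_height c j = a,
      p < j < q /\ code_height c j = minn j s |
      p < j /\ q <= j /\ code_height c j = s.+1].
Proof.
case: c => [[[a p] s] q]; rewrite /code_height /=.
case: (ltngtP j p) => [lt_jp|lt_pj|->]; [by constructor 1| |by constructor 2].
by case: ltnP => ?; [constructor 3|constructor 4].
Qed.

Lemma code_heightP n c : code_ok n c -> is_height n (code_height c).
Proof.
case: c => [[[a p] s] q] ok; split=> [i j le_ij lt_jn | j lt_jn].
  have /= := code_height_spec (a, p, s, q) i.
  have /= := code_height_spec (a, p, s, q) j.
  case=> [[? ->]|[? ->]|[? ->]|[? [? ->]]]; case=> [[? ->]|[? ->]|[? ->]|[? [? ->]]];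
  move: ok => /=; lia.
have /= := code_height_spec (a, p, s, q) j.
case=> [[? ->]|[? ->]|[? ->]|[? [? ->]]]; move: ok => /=; lia.
Qed.

Lemma code_N_free n c : code_ok n c -> N_free n (code_height c).
Proof.
case: c => [[[a p] s] q] ok i1 i2 i3 i4 lt12 lt23 lt34 lt4n; apply/negP.
have /= := code_height_spec (a, p, s, q) i2.
have /= := code_height_spec (a, p, s, q) i3.
have /= := code_height_spec (a, p, s, q) i4.
case=> [[? ->]|[? ->]|[? ->]|[? [? ->]]];
case=> [[? ->]|[? ->]|[? ->]|[? [? ->]]]; try lia;
case=> [[? ->]|[? ->]|[? ->]|[? [? ->]]]; move: ok => /=; lia.
Qed.

Lemma code_diamond_free n c : code_ok n c -> diamond_free n (code_height c).
Proof.
case: c => [[[a p] s] q] ok i1 i2 i3 i4 lt12 lt23 lt34 lt4n; apply/negP.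
have /= := code_height_spec (a, p, s, q) i2.
have /= := code_height_spec (a, p, s, q) i3.
have /= := code_height_spec (a, p, s, q) i4.
case=> [[? ->]|[? ->]|[? ->]|[? [? ->]]];
case=> [[? ->]|[? ->]|[? ->]|[? [? ->]]]; try lia;
case=> [[? ->]|[? ->]|[? ->]|[? [? ->]]]; move: ok => /=; lia.
Qed.

(** If the function is not zero, p is the first index with a nonzero value and a is
    that value.  The last value is s when q = n and s + 1 when q < n; two codes
    of different kinds with the same last value are told apart at s + 1, for
    the s of the code with q < n, and two of the same kind by where the value
    s + 1 begins. *)
Lemma code_height_inj n c c' : code_ok n c -> code_ok n c' ->
  (forall j, j < n -> code_height c j = code_height c' j) -> c = c'.
Proof.
case: c c' => [[[a p] s] q] [[[a' p'] s'] q'] ok ok' eqh.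
move: ok ok' => /= ok ok'.
have le_p : p' <= p.
  rewrite leqNgt; apply/negP => lt_pp'.
  have := eqh p'; have := eqh p.
  rewrite /code_height /= !ltnn !eqxx lt_pp'.
  by rewrite (gtn_eqF lt_pp') [p' < p]ltnNge (ltnW lt_pp') /=; case: ifP; lia.
have ge_p : p <= p'.
  rewrite leqNgt; apply/negP => lt_pp'.
  have := eqh p'; have := eqh p.
  rewrite /code_height /= !ltnn !eqxx lt_pp'.
  by rewrite (gtn_eqF lt_pp') [p < p']ltnNge (ltnW lt_pp') /=; case: ifP; lia.
have eqp : p = p' by lia.
subst p'.
have eqa : a = a' by have := eqh p; rewrite /code_height /= ltnn eqxx; lia.
subst a'.
have T j : p < j -> j < n ->
  (j < q /\ j < q' /\ minn j s = minn j s') \/ (j < q /\ q' <= j /\ minn j s = s'.+1) \/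
  (q <= j /\ j < q' /\ s.+1 = minn j s') \/ (q <= j /\ q' <= j /\ s = s').
  move=> lt_pj /eqh; rewrite /code_height /= [j < p]ltnNge (ltnW lt_pj) (gtn_eqF lt_pj) /=.
  by case: ltnP => ?; case: ltnP => ?; lia.
have eqs : s = s'.
  case: (ltnP p n.-1) => [lt_pn|le_np]; last by clear T eqh; lia.
  have Tn : (q < n) = (q' < n) -> s = s' by move: (T n.-1 lt_pn); clear T eqh; lia.
  case: (ltnP q n) (ltnP q' n) => [lt_q|ge_q] [lt_q'|ge_q']; try by apply: Tn; lia.
    by have := T s.+1; have := T n.-1 lt_pn; clear T Tn eqh; lia.
  by have := T s'.+1; have := T n.-1 lt_pn; clear T Tn eqh; lia.
subst s'; have -> // : q = q'.
by move: (T q) (T q'); clear T eqh; lia.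
Qed.

(** Let m be the last value, p the first index with h p > 0, and a = h p.
    The diamond condition with second index at least p and last index n - 1
    forces h j > j - 1 for p < j < m, so h is the identity there.  The N
    condition on the indices 0, a, p, j shows that a value at most p taken
    after p is a.  So if m <= p then h is constant from p on; otherwise what
    remains is to see where h jumps from m - 1 to m. *)
Lemma height_codeP n h : is_height n h -> N_free n h -> diamond_free n h ->
  exists2 c, code_ok n c & forall j, j < n -> h j = code_height c j.
Proof.
move=> [mono lej] av2 av3.
case: (posnP n) => [->|n_gt0].
  by exists (0, 0, 0, 0).
pose m := h n.-1.
have lem j : j < n -> h j <= m by move=> lt_jn; apply: mono; lia.
have ltmn : m < n by have := lej n.-1; rewrite -/m; lia.
case: (posnP m) => [m0|m_gt0].
  exists (0, 0, 0, n); first by rewrite /= !eqxx.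
  move=> j lt_jn; have := lem j lt_jn; rewrite m0 leqn0 => /eqP ->.
  by rewrite /code_height /= lt_jn minn0; case: ifP.
have [p hp minp] : exists2 p, 0 < h p & forall j, j < p -> h j = 0.
  have ex : exists j, 0 < h j by exists n.-1.
  exists (ex_minn ex); case: ex_minnP => // p hp minp j.
  by case: (posnP (h j)) => // /minp; lia.
have ltpn : p < n by rewrite ltnNge; apply/negP => le_np; have := minp n.-1; lia.
set a := h p in hp.
have leap : a <= p := lej p ltpn.
have geaj j : p <= j -> j < n -> a <= h j by exact: mono.
have diag j : p < j -> j < m -> h j = j.
  move=> ltpj ltjm; have := lej j; have := geaj j.-1.
  by have := av3 0 j.-1 j n.-1; rewrite -/m; lia.
have gap j : p < j -> j < n -> h j <= p -> h j = a.
  move=> ltpj ltjn lejp; have := geaj j; have h0 := minp a.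
  by have := av2 0 a p j; rewrite -/a; lia.
case: (leqP m p) => [lemp|ltpm].
  have eqm : p < n.-1 -> m = a by move=> ?; apply: gap; lia.
  have {}eqm : m = a by case: (ltnP p n.-1) => [/eqm //|?]; rewrite /m /a; congr h; lia.
  have eqj j : p <= j -> j < n -> h j = a.
    by move=> lepj ltjn; have := lem j; have := geaj j; lia.
  exists (a, p, a, n); last first.
    move=> j ltjn; rewrite /code_height /= ltjn; have := minp j; have := eqj j.
    by case: (ltngtP j p) => [||->]; rewrite -/a; lia.
  by rewrite /=; case: (ltngtP a p); lia.
have low j : m <= j -> j < n ->
  (h j == m) || (h j == m.-1) && (a == p) || (h j == m.-1) && (p.+1 < m).
  move=> lemj ltjn; have := lem j ltjn; case: (ltngtP p.+1 m) => [lt|?|eqpm].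
  - by have := diag m.-1; have := mono m.-1 j; lia.
  - by lia.
  case: (eqVneq j n.-1) => [->|ne_j]; first by rewrite -/m eqxx.
  (* the N condition on 0, a, j, n - 1 excludes the value a < p after p *)
  have := gap j; have := minp a; have := av2 0 a j n.-1; rewrite -/m; lia.
case: (leqP m (h m)) => [hm|hm].
  have eqm j : m <= j -> j < n -> h j = m.
    by move=> ? ?; have := lem j; have := mono m j; lia.
  exists (a, p, m, n); first by rewrite /=; lia.
  move=> j ltjn; rewrite /code_height /= ltjn; have := minp j; have := diag j; have := eqm j.
  by case: (ltngtP j p) => [||->]; rewrite -/a; lia.
have [q hq minq] : exists2 q, h q = m & forall j, j < q -> h j != m.
  have ex : exists j, h j == m by exists n.-1.
  exists (ex_minn ex); case: ex_minnP => // q; first by move/eqP.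
  by move=> hq minq j; case: eqP => // /eqP/minq; lia.
have leqn : q <= n.-1 by rewrite leqNgt; apply/negP => /minq; rewrite eqxx.
have ltmq : m < q.
  by rewrite ltnNge; apply/negP => leqm; have := mono q m; lia.
exists (a, p, m.-1, q); first by rewrite /=; have := low m; lia.
move=> j ltjn; rewrite /code_height /=.
case: (ltngtP j p) => [|ltpj|-> //]; first exact: minp.
have := diag j; have := low j; have := minq j; have := mono q j; have := lem j.
by case: (ltnP j q); lia.
Qed.

(** * Counting the codes *)

Definition incr_seqs k m : seq (seq nat) :=
  [seq [seq val i | i <- t]
  | t : k.-tuple 'I_m in [set t : k.-tuple 'I_m | sorted ltn [seq val i | i <- t]]].

Lemma size_incr_seqs k m : size (incr_seqs k m) = 'C(m, k).
Proof. by rewrite size_map -cardE card_ltn_sorted_tuples. Qed.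

Lemma incr_seqs_uniq k m : uniq (incr_seqs k m).
Proof.
rewrite map_inj_uniq ?enum_uniq // => t u /(inj_map val_inj) eq_tu.
exact: val_inj.
Qed.

Lemma mem_incr_seqs k m t :
  (t \in incr_seqs k m) = [&& size t == k, sorted ltn t & all (fun x => x < m) t].
Proof.
apply/mapP/and3P => [[u]|[/eqP szt sort_t /allP lt_t]].
  rewrite mem_enum inE => sort_u ->; rewrite size_map size_tuple; split=> //.
  by apply/allP => _ /mapP[i _ ->]; apply: (ltn_ord i).
have eq_t : [seq val i | i <- pmap (insub : nat -> option 'I_m) t] = t.
  rewrite pmap_filter; last exact: insubK.
  by rewrite -[RHS]filter_predT; apply: eq_in_filter => x /lt_t /= ?; rewrite insubT.
have szu : size (pmap (insub : nat -> option 'I_m) t) == k.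
  by rewrite -szt -[in X in _ == X]eq_t size_map.
by exists (Tuple szu); rewrite ?mem_enum ?inE /= eq_t.
Qed.

(** In order: the antichain; the disjoint unions; the ordinal sums whose two
    extreme summands are antichains, those where only the last one is, those
    where only the first one is, and those where neither is.  The shifts turn
    the inequalities of code_ok, some strict and some not, into strictly
    increasing tuples starting from 0. *)
Definition codes n : seq code :=
  (0, 0, 0, n) ::
  [seq ((nth 0 t 0).+1, (nth 0 t 1).+1, (nth 0 t 0).+1, n)
  | t <- incr_seqs 2 n.-1] ++
  [seq ((nth 0 t 0).+1, (nth 0 t 0).+1, nth 0 t 1, n)
  | t <- incr_seqs 2 n] ++
  [seq ((nth 0 t 0).+1, (nth 0 t 1).+1, (nth 0 t 2).+1, n)
  | t <- incr_seqs 3 n.-1] ++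
  [seq ((nth 0 t 0).+1, (nth 0 t 0).+1, nth 0 t 1, (nth 0 t 2).+1)
  | t <- incr_seqs 3 n.-1] ++
  [seq ((nth 0 t 0).+1, (nth 0 t 1).+1, (nth 0 t 2).+1, (nth 0 t 3).+2)
  | t <- incr_seqs 4 n.-2].

Lemma size_codes n : size (codes n) =
  1 + 'C(n.-1, 2) + 'C(n, 2) + 'C(n.-1, 3) + 'C(n.-1, 3) + 'C(n.-2, 4).
Proof. by rewrite /= !size_cat !(size_incr_seqs, size_map); lia. Qed.

Lemma incr_seqs2P m t : t \in incr_seqs 2 m -> exists x y, t = [:: x; y] /\ x < y < m.
Proof.
by rewrite mem_incr_seqs; case: t => [|x [|y [|z t]]] //= ok; exists x, y; split=> //; lia.
Qed.

Lemma incr_seqs3P m t : t \in incr_seqs 3 m ->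
  exists x y z, t = [:: x; y; z] /\ x < y < z /\ z < m.
Proof.
rewrite mem_incr_seqs; case: t => [|x [|y [|z [|w t]]]] //= ok.
by exists x, y, z; split=> //; lia.
Qed.

Lemma incr_seqs4P m t : t \in incr_seqs 4 m ->
  exists x y z w, t = [:: x; y; z; w] /\ x < y < z /\ z < w < m.
Proof.
rewrite mem_incr_seqs; case: t => [|x [|y [|z [|w [|v t]]]]] //= ok.
by exists x, y, z, w; split=> //; lia.
Qed.

Lemma mem_codes n c : (c \in codes n) = code_ok n c.
Proof.
rewrite !(inE, mem_cat); apply/idP/idP.
  case/orP=> [/eqP -> /=|]; first by rewrite eqxx.
  case/orP=> [/mapP[t /incr_seqs2P[x [y [-> ?]]] ->] /=|]; first by lia.
  case/orP=> [/mapP[t /incr_seqs2P[x [y [-> ?]]] ->] /=|]; first by lia.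
  case/orP=> [/mapP[t /incr_seqs3P[x [y [z [-> ?]]]] ->] /=|]; first by lia.
  case/orP=> [/mapP[t /incr_seqs3P[x [y [z [-> ?]]]] ->] /=|]; first by lia.
  by case/mapP=> [t /incr_seqs4P[x [y [z [w [-> ?]]]]] ->] /=; lia.
have mapI k m (f : seq nat -> code) t : [&& size t == k, sorted ltn t & all (fun x => x < m) t] ->
  f t \in [seq f t | t <- incr_seqs k m] by move=> ?; rewrite map_f // mem_incr_seqs.
case: c => [[[a p] s] q] /=; case/or3P => ok.
- by apply/orP; left; rewrite !xpair_eqE; lia.
- apply/orP; right; apply/orP; left.
  have -> : (a, p, s, q) = (a.-1.+1, p.-1.+1, a.-1.+1, n) by congr (_, _, _, _); lia.
  by apply: (mapI _ _ _ [:: a.-1; p.-1]) => /=; lia.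
case: (ltngtP a p) ok => [lt_ap|lt_pa|eq_ap] ok; [| lia |]; case: (eqVneq q n) ok => [->|ne_qn] ok.
- do 3![apply/orP; right]; apply/orP; left.
  have -> : (a, p, s, n) = (a.-1.+1, p.-1.+1, s.-1.+1, n) by congr (_, _, _, _); lia.
  by apply: (mapI _ _ _ [:: a.-1; p.-1; s.-1]) => /=; lia.
- do 5![apply/orP; right].
  have -> : (a, p, s, q) = (a.-1.+1, p.-1.+1, s.-1.+1, q.-2.+2) by congr (_, _, _, _); lia.
  by apply: (mapI _ _ _ [:: a.-1; p.-1; s.-1; q.-2]) => /=; lia.
- do 2![apply/orP; right]; apply/orP; left.
  have -> : (a, p, s, n) = (p.-1.+1, p.-1.+1, s, n) by congr (_, _, _, _); lia.
  by apply: (mapI _ _ _ [:: p.-1; s]) => /=; lia.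
- do 4![apply/orP; right]; apply/orP; left.
  have -> : (a, p, s, q) = (p.-1.+1, p.-1.+1, s, q.-1.+1) by congr (_, _, _, _); lia.
  by apply: (mapI _ _ _ [:: p.-1; s; q.-1]) => /=; lia.
Qed.

Lemma cat_uniq_pred (T : eqType) (P : pred T) (s t : seq T) :
  all P s -> all (predC P) t -> uniq s -> uniq t -> uniq (s ++ t).
Proof.
move=> /allP Ps /allP Pt us ut; rewrite cat_uniq us ut andbT.
by apply/hasPn => x /Pt; apply: contra => /Ps.
Qed.

Lemma codes_uniq n : uniq (codes n).
Proof.
have inj_in k m (f : seq nat -> code) : {in incr_seqs k m &, injective f} ->
  uniq [seq f t | t <- incr_seqs k m].
  by move=> f_inj; rewrite map_inj_in_uniq ?incr_seqs_uniq.
rewrite /codes -cat1s.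
apply: (@cat_uniq_pred _ (fun c => let: (a, p, s, q) := c in a == 0)) => //=.
  by rewrite !all_cat; apply/and5P; split; apply/allP => _ /mapP[t _ ->].
apply: (@cat_uniq_pred _ (fun c => let: (a, p, s, q) := c in s < p)) => //=.
- by apply/allP=> _ /mapP[t /incr_seqs2P[x [y [-> ?]]] ->] /=; lia.
- rewrite !all_cat; apply/and4P; split; apply/allP=> c /mapP[t].
  + by move=> /incr_seqs2P[x [y [-> ?]]] -> /=; lia.
  + by move=> /incr_seqs3P[x [y [z [-> ?]]]] -> /=; lia.
  + by move=> /incr_seqs3P[x [y [z [-> ?]]]] -> /=; lia.
  + by move=> /incr_seqs4P[x [y [z [w [-> ?]]]]] -> /=; lia.
- apply: inj_in => t u /incr_seqs2P[x [y [-> _]]] /incr_seqs2P[x' [y' [-> _]]] /=.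
  by case=> -> ->.
apply: (@cat_uniq_pred _ (fun c => let: (a, p, s, q) := c in (a == p) && (q == n))) => //=.
- by apply/allP=> _ /mapP[t _ ->] /=; rewrite !eqxx.
- rewrite !all_cat; apply/and3P; split; apply/allP=> c /mapP[t].
  + by move=> /incr_seqs3P[x [y [z [-> ?]]]] -> /=; lia.
  + by move=> /incr_seqs3P[x [y [z [-> ?]]]] -> /=; lia.
  + by move=> /incr_seqs4P[x [y [z [w [-> ?]]]]] -> /=; lia.
- apply: inj_in => t u /incr_seqs2P[x [y [-> _]]] /incr_seqs2P[x' [y' [-> _]]] /=.
  by case=> -> _ ->.
apply: (@cat_uniq_pred _ (fun c => let: (a, p, s, q) := c in q == n)) => //=.
- by apply/allP=> _ /mapP[t _ ->] /=; rewrite !eqxx.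
- rewrite !all_cat; apply/andP; split; apply/allP=> c /mapP[t].
  + by move=> /incr_seqs3P[x [y [z [-> ?]]]] -> /=; lia.
  + by move=> /incr_seqs4P[x [y [z [w [-> ?]]]]] -> /=; lia.
- apply: inj_in => t u /incr_seqs3P[x [y [z [-> _]]]] /incr_seqs3P[x' [y' [z' [-> _]]]] /=.
  by case=> -> -> ->.
apply: (@cat_uniq_pred _ (fun c => let: (a, p, s, q) := c in a == p)) => //=.
- by apply/allP=> _ /mapP[t _ ->] /=; rewrite !eqxx.
- by apply/allP=> _ /mapP[t /incr_seqs4P[x [y [z [w [-> ?]]]]] ->] /=; lia.
- apply: inj_in => t u /incr_seqs3P[x [y [z [-> _]]]] /incr_seqs3P[x' [y' [z' [-> _]]]] /=.
  by case=> -> _ -> ->.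
apply: inj_in => t u /incr_seqs4P[x [y [z [w [-> _]]]]] /incr_seqs4P[x' [y' [z' [w' [-> _]]]]] /=.
by case=> -> -> -> ->.
Qed.

(** The patterns are variables, so that the simplification does not unfold
    concrete ones. *)
Lemma in_stoimenow_avoiding3 n M Q1 Q2 Q3 :
  (M \in stoimenow_avoiding n [:: Q1; Q2; Q3]) =
  [&& is_stoimenow M, ~~ contains M Q1, ~~ contains M Q2 & ~~ contains M Q3].
Proof. by rewrite inE /= andbT. Qed.

Lemma stoimenow_avoidingE n M : (M \in stoimenow_avoiding n [:: P1; P2; P3]) =
  (M \in [seq height_matching n (code_height c) | c <- codes n]).
Proof.
rewrite in_stoimenow_avoiding3; apply/idP/mapP => [|[c]].
  case/and4P=> stM no1 no2 no3.
  have mM : is_matching M by case/and3P: stM.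
  have [h hP defM] := nonnesting_height mM (avoids_P1_nonnesting stM no1).
  rewrite defM in no2 no3; move/(height_N_freeP hP): no2 => av2.
  move/(height_diamond_freeP hP): no3 => av3.
  have [c okc eq_hc] := height_codeP hP av2 av3.
  exists c; first by rewrite mem_codes.
  rewrite defM; congr (arcs_of n _); apply/eq_in_map => j; rewrite mem_iota => lt_j.
  rewrite /opener /closer eq_hc //; congr (_, (_ + _).+1).
  by apply: eq_in_count => i; rewrite mem_iota => lt_i; rewrite eq_hc.
rewrite mem_codes => okc ->; have hP := code_heightP okc.
have nn := height_matching_nonnesting hP.
apply/and4P; split.
- exact: nonnesting_stoimenow (height_matching_is_matching hP) nn.
- exact: nonnesting_avoids_P1.
- exact/(height_N_freeP hP)/code_N_free.
- exact/(height_diamond_freeP hP)/code_diamond_free.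
Qed.

Lemma card_stoimenow_avoiding n : #|stoimenow_avoiding n [:: P1; P2; P3]| =
  1 + 'C(n.-1, 2) + 'C(n, 2) + 'C(n.-1, 3) + 'C(n.-1, 3) + 'C(n.-2, 4).
Proof.
rewrite (eq_card (@stoimenow_avoidingE n)).
rewrite (card_uniqP _) ?size_map ?size_codes // map_inj_in_uniq ?codes_uniq //.
move=> c c'; rewrite !mem_codes => okc okc' eq_cc'; apply: (code_height_inj okc okc').
exact: height_matching_inj (code_heightP okc) (code_heightP okc') eq_cc'.
Qed.

(** * The generating function *)

Import GRing.Theory.

Section FPS.
Local Open Scope ring_scope.
Variable K : fieldType.

Lemma fps_mulIf (g u v : fps K) : g 0%N != 0 ->
  fps_mul u g =1 fps_mul v g -> u =1 v.
Proof.
move=> g0 eq_uv; elim/ltn_ind => n IHn.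
have := eq_uv n; rewrite /fps_mul !big_ord_recr /= subnn.
rewrite (eq_bigr (fun k : 'I_n => v k * g (n - k)%N)) => [|k _]; last by rewrite IHn.
by move/addrI/(mulIf g0).
Qed.

(** Moving a factor 1 - X from one series to the other replaces the latter by its
    difference sequence. *)
Lemma fps_mul_subX (u : fps K) (p : {poly K}) :
  fps_mul u (fps_of_poly ((1 - 'X) * p)) =1
  fps_mul (fun n => if n is m.+1 then u m.+1 - u m else u 0%N) (fps_of_poly p).
Proof.
move=> n; rewrite /fps_mul /fps_of_poly.
have shift k : (k <= n)%N ->
  ((1 - 'X) * p)`_(n - k) = p`_(n - k) - (if (k < n)%N then p`_(n - k.+1) else 0).
  move=> le_kn; rewrite mulrBl mul1r coefB coefXM subn_eq0 leqNgt subnS.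
  by case: ltnP.
under eq_bigr => k _ do rewrite (shift k (ltn_ord k)) mulrBr.
rewrite sumrB [in X in _ - X]big_ord_recr /= ltnn mulr0 addr0.
rewrite [X in _ - X](eq_bigr (fun k : 'I_n => u k * p`_(n - k.+1))) => [|k _]; last first.
  by rewrite ltn_ord.
rewrite !big_ord_recl /= -addrA -sumrB; congr (_ + _).
by apply: eq_bigr => k _; rewrite /bump /= add1n mulrBl.
Qed.

(** Pascal's rule says that the difference sequence of C(n + r + 1, r + 1) is
    C(n + r, r); so each factor 1 - X lowers r by one. *)
Lemma fps_inv_expSubX r :
  fps_inv (fps_of_poly ((1 - 'X : {poly K}) ^+ r.+1)) =1
  (fun n => ('C(n + r, r))%:R).
Proof.
have g0 : fps_of_poly ((1 - 'X : {poly K}) ^+ r.+1) 0%N != 0.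
  rewrite /fps_of_poly -horner_coef0 horner_exp !hornerE subr0.
  by rewrite expr1n oner_eq0.
apply: (fps_mulIf g0) => n; rewrite fps_mulVf //; apply/esym.
elim: r n {g0} => [|r IHr] n; rewrite exprS fps_mul_subX; last first.
  rewrite -IHr /fps_mul; apply: eq_bigr => [[[|k] _] _] /=; congr (_ * _).
    by rewrite !add0n !binn.
  by rewrite addSn binS addnS natrD addrAC subrr add0r.
rewrite /fps_mul big_ord_recl /= big1 => [|k _]; last first.
  by rewrite !bin0 subrr mul0r.
by rewrite bin0 mul1r subn0 addr0.
Qed.

End FPS.

Local Open Scope ring_scope.

Lemma coef_fps_div_card n : fps_div
       (fps_of_poly (1 - 4 *: 'X + 7 *: 'X^2 - 5 *: 'X^3 + 2 *: 'X^4
                     - 'X^5 + 'X^6 : {poly rat}))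
       (fps_of_poly ((1 - 'X) ^+ 5 : {poly rat})) n =
    (1 + 'C(n.-1, 2) + 'C(n, 2) + 'C(n.-1, 3) + 'C(n.-1, 3) + 'C(n.-2, 4))%:R.
Proof.
rewrite /fps_div.
set P := (X in fps_of_poly X).
have -> : fps_mul (fps_of_poly P) (fps_inv (fps_of_poly ((1 - 'X) ^+ 5))) n
  = \sum_(k < 7) P`_k * ('C(n + 4 - k, 4))%:R.
  have cP k : (6 < k)%N -> P`_k = 0.
    move=> lt6k; rewrite /P !(coefD, coefN, coefZ, coefXn, coefX, coef1).
    by do 7?case: k lt6k => // k lt6k; rewrite /= !mulr0 !(addr0, subr0).
  rewrite /fps_mul.
  under eq_bigr => k _ do rewrite fps_inv_expSubX addnC addnBA -1?ltnS // addnC.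
  (* F k is the product of two coefficients for k <= n and vanishes for k > n,
     even when n + 4 - k is a truncated difference *)
  pose F k := P`_k * ('C(n + 4 - k, 4))%:R.
  rewrite -(big_mkord xpredT F) -[RHS](big_mkord xpredT F).
  have Fbig k : (n < k)%N -> F k = 0.
    by move=> lt_nk; rewrite /F bin_small ?mulr0 //; lia.
  have F6 k : (6 < k)%N -> F k = 0 by move=> lt6k; rewrite /F cP ?mul0r.
  have ext m m' : (m <= m')%N -> (forall k, (m <= k)%N -> F k = 0) ->
    \sum_(0 <= k < m) F k = \sum_(0 <= k < m') F k.
    move=> le_mm' F0; rewrite (big_cat_nat (leq0n m) le_mm') /=.
    by rewrite [X in _ + X]big_nat_cond [X in _ + X]big1 ?addr0 // => k /andP[/andP[/F0]].
  by rewrite (ext n.+1 (n + 7)%N) ?(ext 7%N (n + 7)%N) //; lia.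
rewrite !big_ord_recl big_ord0 /P !(coefD, coefN, coefZ, coefXn, coefX, coef1) /=.
rewrite /bump /= !add1n.
case: n => [|[|n]]; rewrite ?addn4 ?subSS ?subn0 /=; [by []|by []|].
(* Pascal's rule makes both sides linear in the binomials C(n, j), j <= 4; the
   two values of n for which n - 2 is truncated are computed above *)
rewrite !(binS, bin0, bin1) !natrD; ring.
Qed.

Theorem theorem4p1 :
  (fun n : nat => (#|stoimenow_avoiding n [:: P1; P2; P3]|)%:R : rat)
  =1 fps_div
       (fps_of_poly (1 - 4 *: 'X + 7 *: 'X^2 - 5 *: 'X^3 + 2 *: 'X^4
                     - 'X^5 + 'X^6 : {poly rat}))
       (fps_of_poly ((1 - 'X) ^+ 5 : {poly rat})).
Proof. by move=> n; rewrite card_stoimenow_avoiding coef_fps_div_card. Qed.
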